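(* Let $q$ be a positive power of a prime and let $\mathbb{F}_q$ be the finite field of $q$ elements. Suppose $f\in\mathbb{F}_q[X]$ is a polynomial for which $N_2(f)=q-1$. Then $$\frac{q+1}{2} \le V(f) \le q - \frac{2(q-1)}{1+\sqrt{4q-3}}.$$
   Context: A polynomial $f\in\mathbb{F}_q[X]$ is regarded as the function $\mathbb{F}_q\to\mathbb{F}_q$, $x\mapsto f(x)$. $V(f)=|f(\mathbb{F}_q)|$ is the number of distinct values of this function. $N_2(f)$ is the number of ordered pairs $(x_1,x_2)\in\mathbb{F}_q\times\mathbb{F}_q$ with $x_1\neq x_2$ and $f(x_1)=f(x_2)$. *)

(* Defs.v *)
From HB Require Import structures.
From mathcomp Require Import all_boot all_order all_algebra.

Set Implicit Arguments.
Unset Strict Implicit.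
Unset Printing Implicit Defensive.

Import GRing.Theory.
Local Open Scope ring_scope.

Definition V (F : finFieldType) (f : {poly F}) : nat :=
  #|[set f.[x] | x : F]|.

(* Pairs are ordered: (x1, x2) and (x2, x1) are both counted. *)
Definition N2 (F : finFieldType) (f : {poly F}) : nat :=
  #|[set x : F * F | (x.1 != x.2) && (f.[x.1] == f.[x.2])]|.

(* Main.v *)
Require Import Defs.
From HB Require Import structures.
From mathcomp Require Import all_boot all_order all_algebra.
From mathcomp Require Import ring lra.

(** Only the fibre sizes of the function matter.  Let the [excess] of a value
    be the size of its fibre minus one, and let [D] be the sum of all excesses,
    so that [D = q - V].  A fibre of excess [d] contributes [d * (d + 1)]
    ordered pairs of distinct points, hence [N2] is the sum of [d * (d + 1)]
    over all values.

    - Since [2 * d <= d * (d + 1)] for natural [d], we get [2 * D <= N2]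
      ([double_defect_le_collisions]), which for [N2 = q - 1] is the lower bound
      on [V].
    - Since a single excess is at most [D], we get [N2 <= D * (D + 1)]
      ([collisions_le_defect]), so [q - 1 <= D * (D + 1)].  Thus [D] is at least
      the positive root of [X^2 + X - (q - 1)], which is
      [(sqrt (4 q - 3) - 1) / 2]; multiplying by the conjugate turns this
      root into [2 (q - 1) / (1 + sqrt (4 q - 3))]. *)

Set Implicit Arguments.
Unset Strict Implicit.
Unset Printing Implicit Defensive.

Import Order.TTheory GRing.Theory Num.Theory.
Local Open Scope ring_scope.

Section FibreCounting.
Local Open Scope nat_scope.

Variables (T U : finType) (g : T -> U).

Definition excess (y : U) : nat := #|[set x | g x == y]|.-1.

Definition defect : nat := \sum_(y in [set g x | x : T]) excess y.

Definition collisions : nat :=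
  #|[set x : T * T | (x.1 != x.2) && (g x.1 == g x.2)]|.

Lemma card_fibre y : y \in [set g x | x : T] ->
  #|[set x | g x == y]| = (excess y).+1.
Proof.
case/imsetP => x _ ->; rewrite /excess prednK //.
by apply/card_gt0P; exists x; rewrite inE.
Qed.

Lemma sum_over_fibres (F : U -> nat) :
  \sum_(x : T) F (g x) = \sum_(y in [set g x | x : T]) (excess y).+1 * F y.
Proof.
rewrite (partition_big_imset g) /=; apply: eq_bigr => y yA.
rewrite -card_fibre // (eq_bigr (fun=> F y)) => [|x /eqP -> //].
by rewrite sum_nat_cond_const; congr (_ * _); apply: eq_card => x; rewrite !inE.
Qed.

Lemma card_image_defect : #|[set g x | x : T]| + defect = #|T|.
Proof.
have /= sumT := sum_over_fibres (fun=> 1).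
rewrite -[RHS]sum1_card [RHS]sumT -sum1_card -big_split /=.
by apply: eq_bigr => y _; rewrite muln1 add1n.
Qed.

(** A point [x] is the first component of as many collisions as its fibre has
    other points, that is, of [excess (g x)] collisions. *)
Lemma collisionsE :
  collisions = \sum_(y in [set g x | x : T]) (excess y).+1 * excess y.
Proof.
rewrite -sum_over_fibres /collisions -sum1dep_card.
rewrite -(pair_big_dep xpredT (fun x1 x2 => (x1 != x2) && (g x1 == g x2))
            (fun _ _ => 1)) /=.
apply: eq_bigr => x _; rewrite sum1dep_card.
rewrite /excess [X in _ = X.-1](cardsD1 x) inE eqxx /=.
by apply: eq_card => z; rewrite !inE [z == x]eq_sym [g z == _]eq_sym.
Qed.

(** Equality holds exactly when every excess is 0 or 1: for a given number of
    collisions the image is smallest when no fibre has more than two points. *)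
Lemma double_defect_le_collisions : 2 * defect <= collisions.
Proof.
rewrite collisionsE /defect big_distrr /=; apply: leq_sum => y _.
by case: (excess y) => // d; rewrite leq_mul2r.
Qed.

(** Equality holds when a single fibre carries the whole defect: for a given
    number of collisions this is the shape with the largest image. *)
Lemma collisions_le_defect : collisions <= defect.+1 * defect.
Proof.
rewrite collisionsE [X in _ <= _ * X]/defect big_distrr /=.
apply: leq_sum => y yA; rewrite leq_mul2r ltnS.
by rewrite /defect (bigD1 y) //= leq_addr orbT.
Qed.

End FibreCounting.

(** [2 a / (1 + sqrt (4 a + 1))] is the nonnegative root of [X^2 + X - a], in
    the form conjugate to the quadratic formula; [X^2 + X] is increasing for
    nonnegative [X]. *)
Lemma ge_quadratic_root (R : rcfType) (a d : R) :
  0 <= a -> 0 <= d -> a <= (d + 1) * d ->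
  2 * a / (1 + Num.sqrt (4 * a + 1)) <= d.
Proof.
move=> a0 d0 le_ad; set s := Num.sqrt _.
have s0 : 0 <= s by exact: sqrtr_ge0.
have s2 : s ^+ 2 = 4 * a + 1 by rewrite sqr_sqrtr //; lra.
have le_s : s <= 2 * d + 1.
  by rewrite -(@ler_pXn2r _ 2) ?nnegrE //; nra.
rewrite ler_pdivrMr; nra.
Qed.

Theorem theorem3 (R : rcfType) (F : finFieldType) (q : nat) (hq : #|F| = q)
    (f : {poly F}) (hf : N2 f = (q - 1)%N) :
  (q%:R + 1) / 2 <= (V f)%:R :> R /\
  (V f)%:R <= q%:R - 2 * (q%:R - 1) / (1 + Num.sqrt (4 * q%:R - 3)) :> R.
Proof.
pose D := defect (horner f).
have q_gt0 : (0 < q)%N by rewrite -hq; apply/card_gt0P; exists 0.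
have eqVD : (V f + D)%N = q by rewrite -hq -(card_image_defect (horner f)).
have lower : (2 * D <= q - 1)%N.
  by rewrite -hf; exact: double_defect_le_collisions.
have upper : (q - 1 <= D.+1 * D)%N by rewrite -hf; exact: collisions_le_defect.
have eqVD_R : (V f)%:R + D%:R = q%:R :> R by rewrite -natrD eqVD.
split.
  have : (2 * D)%:R <= (q - 1)%:R :> R by rewrite ler_nat.
  by rewrite natrM natrB // => ?; lra.
have le_qD : q%:R - 1 <= (D%:R + 1) * D%:R :> R.
  by rewrite natr1 -natrM -(@natrB R q 1) // ler_nat.
have q1_ge0 : 0 <= q%:R - 1 :> R by rewrite subr_ge0 ler1n.
have := ge_quadratic_root q1_ge0 (ler0n R D) le_qD.
have -> : 4 * (q%:R - 1) + 1 = 4 * q%:R - 3 :> R by ring.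
by move=> ?; lra.
Qed.
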